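(* Let $H$ be a complex Hilbert space (not necessarily separable) with $\dim H\ge 2$. For any effects $A,B\in\mathcal{E}(H)$ the following are equivalent: (i) $B\in\{A,A^\perp\}$ or $A,B\in\mathcal{SC}(H)$; (ii) $A^\sim=B^\sim$. Moreover, if $H$ is separable, then (i) and (ii) are also equivalent to (iii) $A^\sim\cap\mathcal{F}(H)=B^\sim\cap\mathcal{F}(H)$.
   Context: An effect on $H$ is a bounded self-adjoint operator $A$ on $H$ with $0\le A\le I$; $\mathcal{E}(H)$ is the set of all effects. $A^\perp:=I-A$. $\mathcal{SC}(H)=\{tI: t\in[0,1]\}$ is the set of scalar effects and $\mathcal{F}(H)$ is the set of finite-rank effects. Two effects $A,B\in\mathcal{E}(H)$ are coexistent, written $A\sim B$, if there are $E,F,G\in\mathcal{E}(H)$ with $A=E+G$, $B=F+G$ and $E+F+G\in\mathcal{E}(H)$. For $A\in\mathcal{E}(H)$, $A^\sim:=\{C\in\mathcal{E}(H): C\sim A\}$. *)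

(* Defs.v *)
From HB Require Import structures.
From mathcomp Require Import all_boot all_order all_algebra.
From mathcomp Require Import complex.
From mathcomp Require Import all_classical all_reals.
From mathcomp Require Import topology normedtype.

Set Implicit Arguments.
Unset Strict Implicit.
Unset Printing Implicit Defensive.

Import Order.TTheory GRing.Theory Num.Theory.
Import numFieldNormedType.Exports.

Local Open Scope classical_set_scope.
Local Open Scope complex_scope.
Local Open Scope ring_scope.

(* [inner] is linear in its first argument and conjugate-linear in its second. *)
HB.mixin Record isHilbert (R : realType) H of CompleteNormedModule R[i] H := {
  inner : {dot H for @Num.conj R[i]};
  innerxx : forall x : H, inner x x = `|x| ^+ 2
}.

#[short(type="hilbertType")]
HB.structure Definition Hilbert (R : realType) :=
  { H of isHilbert R H & CompleteNormedModule R[i] H }.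

Arguments inner {R H} : rename.

Section HilbertSpace.
Variables (R : realType) (H : hilbertType R).
Implicit Types (A B C : H -> H).

Definition dim_ge (n : nat) : Prop :=
  exists v : 'I_n -> H, forall c : 'I_n -> R[i],
    \sum_(i < n) c i *: v i = 0 -> forall i, c i = 0.

Definition separable : Prop := exists2 D : set H, countable D & dense D.

Definition bounded_operator A : Prop :=
  linear A /\ exists M : R, forall x, `|A x| <= M%:C * `|x|.

Definition self_adjoint A : Prop := forall x y, inner (A x) y = inner x (A y).

(* The order of R[i] makes [0 <= z] imply that z is real. *)
Definition ople A B : Prop := forall x, 0 <= inner ((B - A) x) x.

Definition effects : set (H -> H) :=
  [set A | [/\ bounded_operator A, self_adjoint A, ople 0 A & ople A idfun]].

Definition perp A : H -> H := idfun - A.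

Definition scalar_effects : set (H -> H) :=
  [set A | exists2 t : R, 0 <= t <= 1 & A = t%:C *: idfun].

Definition finite_rank A : Prop :=
  exists n (v : 'I_n -> H), forall x,
    exists c : 'I_n -> R[i], A x = \sum_(i < n) c i *: v i.

Definition finite_rank_effects : set (H -> H) := effects `&` finite_rank.

Definition coexistent A B : Prop :=
  exists E F G : H -> H,
    [/\ effects E, effects F & effects G] /\
    [/\ A = E + G, B = F + G & effects (E + F + G)].

Definition coexistent_set A : set (H -> H) :=
  [set C | effects C /\ coexistent C A].

End HilbertSpace.

Arguments finite_rank_effects {R H}.

(* Main.v *)
Require Import Defs.
From mathcomp Require Import all_boot all_order all_algebra.
From mathcomp Require Import complex polyrcf.
From mathcomp Require Import all_classical all_reals.
From mathcomp Require Import topology normedtype.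
From mathcomp Require Import ring lra.

(** The implication from (i) to (ii) is a matter of rearranging decompositions
([coexistent_perp], [scalar_coexistent]), and (iii) follows from (ii) at once.
The content is that (iii) implies (i), and rank-one effects suffice for it.

Let [s_A(x)] be the largest [s] with [s <., x> x <= A].  By
[coexistent_rank1], the operator [t <., x> x] is an effect coexistent with [A]
exactly when [t <= s_A(x) + s_A'(x)], where [A' = I - A].  So (iii) says that
[A] and [B] have the same function [s_A + s_A'].  Now [1 / s_A(x)] is the
Fenchel conjugate [N_A(x) = sup_y (2 Re <y, x> - <A y, y>)], which is
[<A^-1 x, x>] when [A] is invertible, and [s_A(x) = 0] where it is infinite.
Conjugates have two properties that replace inverses, square roots and the
spectral theorem.  They satisfy the parallelogram law, hence are quadratic
polynomials on each real line of the subspace where they are finite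
([fconj_line]); and if two of them are proportional then so are the operators
([fconj_le_qf]).  The hypothesis reads
[1 / N_A + 1 / N_A' = 1 / N_B + 1 / N_B'].

If one of the conjugates, say [N_A], is infinite somewhere, it is infinite at
generic points of every line that leaves its domain.  There the identity has
fewer terms; since the domains of [N_A] and [N_A'] span the space, this leads
to [N_A' = N_B'] or [N_A' = N_B] up to the trivial case [A = 0]
([unbounded_case]).

If all four are finite everywhere, their restrictions to a real line that
avoids 0 are positive quadratic polynomials, so they are irreducible.  Unique
factorisation in the identity with its denominators cleared shows that [N_A]
is proportional to [N_A'], [N_B] or [N_B'] on the line, and a generic point
argument makes the choice the same for all lines ([bounded_multiple]).  The
same holds for [N_A'].  Either [A] and [I - A] are proportional and [A] is
scalar, or [A] and [I - A] are proportional to [B] and [I - B] in some order,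
which for a nonscalar [A] means that they are equal to them ([bounded_case]).

Finally, a scalar effect coexists with every projection on a line.  If [A] is
scalar, these projections therefore coexist with [B], which makes every vector
an eigenvector of [B] ([scalar_transfer]). *)

Set Implicit Arguments.
Unset Strict Implicit.
Unset Printing Implicit Defensive.

Import Order.TTheory GRing.Theory Num.Theory.
Import numFieldNormedType.Exports.

Local Open Scope classical_set_scope.
Local Open Scope complex_scope.
Local Open Scope ring_scope.

(** * The real inner product and the quadratic form of an operator *)

Section RealInner.
Variables (R : realType) (H : hilbertType R).
Implicit Types (x y z : H) (s t : R) (A B : H -> H).

(** The conjugates below only see [H] as a real inner product space: real
scalings are enough for them, and every inequality is one between reals. *)
Definition rdot x y : R := complex.Re (inner x y).

Lemma innerC x y : inner x y = (inner y x)^*%C.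
Proof. by rewrite (hermC inner) expr0 mul1r. Qed.

Lemma rdotC x y : rdot x y = rdot y x.
Proof. by rewrite /rdot innerC; case: (inner y x). Qed.

Lemma rdotDl x y z : rdot (x + y) z = rdot x z + rdot y z.
Proof. by rewrite /rdot linearDl /=; case: (inner x z); case: (inner y z). Qed.

Lemma rdotZl t x z : rdot (t%:C *: x) z = t * rdot x z.
Proof. by rewrite /rdot linearZl_LR /=; case: (inner x z) => a b /=; rewrite mul0r subr0. Qed.

Lemma rdotNl x z : rdot (- x) z = - rdot x z.
Proof. by rewrite /rdot linearNl /=; case: (inner x z). Qed.

Lemma rdotDr x y z : rdot z (x + y) = rdot z x + rdot z y.
Proof. by rewrite ![rdot z _]rdotC rdotDl. Qed.

Lemma rdotZr t x z : rdot z (t%:C *: x) = t * rdot z x.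
Proof. by rewrite ![rdot z _]rdotC rdotZl. Qed.

Lemma rdotNr x z : rdot z (- x) = - rdot z x.
Proof. by rewrite ![rdot z _]rdotC rdotNl. Qed.

Lemma rdot0l x : rdot 0 x = 0. Proof. by rewrite /rdot linear0l. Qed.
Lemma rdot0r x : rdot x 0 = 0. Proof. by rewrite rdotC rdot0l. Qed.

Definition rdotE := (rdotDl, rdotDr, rdotNl, rdotNr, rdotZl, rdotZr).

Lemma inner_ge0 x : 0 <= inner x x.
Proof. by rewrite innerxx exprn_ge0. Qed.

Lemma rdotxx x : (rdot x x)%:C = inner x x.
Proof. by rewrite /rdot RRe_real // ger0_real // inner_ge0. Qed.

Lemma rdot_ge0 x : 0 <= rdot x x.
Proof. by rewrite -ler0c rdotxx inner_ge0. Qed.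

Lemma rdot_eq0 x : rdot x x = 0 -> x = 0.
Proof.
move=> h; have := rdotxx x; rewrite h innerxx => /esym/eqP.
by rewrite sqrf_eq0 normr_eq0 => /eqP.
Qed.

Lemma rdot_gt0 x : x != 0 -> 0 < rdot x x.
Proof.
by move=> nx; rewrite lt_neqAle rdot_ge0 andbT eq_sym; apply: contra nx => /eqP/rdot_eq0->.
Qed.

Lemma rdot_inj x y : (forall z, rdot x z = rdot y z) -> x = y.
Proof.
move=> h; apply/eqP; rewrite -subr_eq0; apply/eqP/rdot_eq0.
by rewrite rdotDl rdotNl h subrr.
Qed.

Definition qf A x := rdot (A x) x.

(** The part of linearity and self-adjointness that survives when [H] is regarded as a
real space. *)
Definition rsym A :=
  [/\ forall x y, A (x + y) = A x + A y,
      forall t x, A (t%:C *: x) = t%:C *: A x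
    & forall x y, rdot (A x) y = rdot x (A y)].

Lemma self_adjoint_qf A x : self_adjoint A -> (qf A x)%:C = inner (A x) x.
Proof.
move=> sA; rewrite /qf /rdot; apply: RRe_real.
by apply/CrealP; rewrite [X in X = _](_ : _ = (inner (A x) x)^*%C) // -innerC sA.
Qed.

(** Self-adjointness makes the complex inequalities of [effects] real. *)
Lemma effectsP A : effects A <->
  [/\ bounded_operator A, self_adjoint A, forall x, 0 <= qf A x
    & forall x, qf A x <= rdot x x].
Proof.
have e1 x : inner ((A - (0 : H -> H)) x) x = inner (A x) x.
  by rewrite (_ : (A - _) x = A x - 0) ?subr0.
have e2 x : inner (((idfun : H -> H) - A) x) x = inner x x - inner (A x) x.
  by rewrite (_ : (_ - A) x = x - A x) // linearBl.
split=> -[bA sA h0 h1]; split=> // x.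
- by rewrite -ler0c self_adjoint_qf // -e1; exact: h0.
- by rewrite -subr_ge0 -ler0c rmorphB /= rdotxx self_adjoint_qf // -e2; exact: h1.
- by rewrite e1 -self_adjoint_qf // ler0c.
- by rewrite e2 -rdotxx -self_adjoint_qf // -rmorphB /= ler0c subr_ge0.
Qed.

Lemma effects_rsym A : effects A -> rsym A.
Proof.
move=> /effectsP[[lA _] sA _ _]; split.
- by move=> x y; have := lA 1 x y; rewrite !scale1r.
- move=> t x; have := lA t%:C x 0; rewrite !addr0 => ->.
  have -> : A 0 = 0 by have := lA (-1) 0 0; rewrite !scaleN1r oppr0 addr0 addNr.
  by rewrite addr0.
- by move=> x y; rewrite /rdot sA.
Qed.

End RealInner.

(** * The conjugate of a positive quadratic form *)

Section Conjugate.
Variables (R : realType) (H : hilbertType R).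
Implicit Types (x y z : H) (s t m : R) (A B : H -> H).

Definition psd A := rsym A /\ forall x, 0 <= qf A x.

(** Says that the Fenchel conjugate of [qf A] at [x] is at most [m].  The
relational form avoids extended reals: where the conjugate is infinite no
[m] satisfies it. *)
Definition conj_le A x m := forall y, 2 * rdot y x - qf A y <= m.
Definition dom A x := exists m, conj_le A x m.
(** For positive invertible [A] this is the quadratic form of the inverse; for
positive [A] in general it is meaningful on [dom A], which is the range of the square root
of [A]. *)
Definition fconj A x : R := sup [set 2 * rdot y x - qf A y | y in setT].

Lemma qfD A x y : rsym A -> qf A (x + y) = qf A x + 2 * rdot (A x) y + qf A y.
Proof.
move=> [aD _ aS]; rewrite /qf aD !rdotE (rdotC (A y) x) -aS; ring.
Qed.

Lemma qfZ A t x : rsym A -> qf A (t%:C *: x) = t ^+ 2 * qf A x.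
Proof. by move=> [_ aZ aS]; rewrite /qf aZ !rdotE; ring. Qed.

Lemma rsymN A x : rsym A -> A (- x) = - A x.
Proof.
by move=> [_ aZ _]; have := aZ (-1) x; rewrite rmorphN1 !scaleN1r.
Qed.

Lemma rsym0 A : rsym A -> A 0 = 0.
Proof. by move=> [_ aZ _]; have := aZ 0 0; rewrite !scale0r. Qed.

Lemma qf0 A : rsym A -> qf A 0 = 0.
Proof. by move=> sA; rewrite /qf rdot0r. Qed.

Lemma qfN A x : rsym A -> qf A (- x) = qf A x.
Proof. by move=> sA; rewrite /qf rsymN // !rdotE opprK. Qed.

Lemma fconj_leP A x m : dom A x -> fconj A x <= m <-> conj_le A x m.
Proof.
move=> [m0 h0]; split=> [h y|h].
- apply: le_trans h; apply: ub_le_sup; last by exists y.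
  by exists m0 => _ [z _ <-].
- by apply: ge_sup; [exists (2 * rdot 0 x - qf A 0), 0 | move=> _ [z _ <-]].
Qed.

Lemma fconj_ub A x : dom A x -> conj_le A x (fconj A x).
Proof. by move=> d; apply/fconj_leP. Qed.

Lemma conj_le_dom A x m : conj_le A x m -> dom A x.
Proof. by exists m. Qed.

Lemma conj_le_fconj A x m : conj_le A x m -> fconj A x <= m.
Proof. by move=> h; apply/fconj_leP => //; exists m. Qed.

Lemma conj_le_ge0 A x m : rsym A -> conj_le A x m -> 0 <= m.
Proof. by move=> sA /(_ 0); rewrite rdot0l qf0 // mulr0 subr0. Qed.

Lemma fconj_ge0 A x : rsym A -> dom A x -> 0 <= fconj A x.
Proof. by move=> sA /fconj_ub/conj_le_ge0; exact. Qed.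

Lemma conj_leZ A x m t : psd A -> conj_le A x m -> conj_le A (t%:C *: x) (t ^+ 2 * m).
Proof.
move=> [sA pA] h y; have [->|t0] := eqVneq t 0.
  by rewrite scale0r rdot0r mulr0 expr0n mul0r sub0r oppr_le0.
have := h ((t^-1)%:C *: y); rewrite qfZ // !rdotE.
have t2 : 0 < t ^+ 2 by rewrite exprn_even_gt0.
move=> /(ler_wpM2l (ltW t2)); apply: le_trans; rewrite le_eqVlt; apply/orP; left.
by apply/eqP; field.
Qed.

(** The substitution of [(u + v) / 2] and [(u - v) / 2] for the test vectors
turns the parallelogram law of [qf A] into the one of its conjugate. *)
Lemma conj_le_sum A x y u v : psd A -> dom A x -> dom A y ->
  (2 * rdot u (x + y) - qf A u) + (2 * rdot v (x - y) - qf A v)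
    <= 2 * fconj A x + 2 * fconj A y.
Proof.
move=> [sA pA] dx dy.
have := fconj_ub dx ((2^-1)%:C *: (u + v)); have := fconj_ub dy ((2^-1)%:C *: (u - v)).
rewrite !qfZ // !qfD // qfN // !rdotE => h1 h2.
by lra.
Qed.

Lemma dom0 A : psd A -> dom A 0.
Proof. by move=> [sA pA]; exists 0 => y; rewrite rdot0r mulr0 sub0r oppr_le0. Qed.

Lemma domD A x y : psd A -> dom A x -> dom A y -> dom A (x + y).
Proof.
move=> pA dx dy; exists (2 * fconj A x + 2 * fconj A y) => u.
have := conj_le_sum u 0 pA dx dy; rewrite rdot0l qf0; last by case: pA.
by rewrite mulr0 subr0 addr0.
Qed.

Lemma domZ A t x : psd A -> dom A x -> dom A (t%:C *: x).
Proof. by move=> pA [m h]; exists (t ^+ 2 * m); exact: conj_leZ. Qed.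

Lemma domN A x : psd A -> dom A x -> dom A (- x).
Proof. by move=> pA /(domZ (-1) pA); rewrite rmorphN1 scaleN1r. Qed.

Lemma domB A x y : psd A -> dom A x -> dom A y -> dom A (x - y).
Proof. by move=> pA dx dy; apply: domD => //; exact: domN. Qed.

Lemma domK A x y : psd A -> dom A y -> dom A (x + y) -> dom A x.
Proof. by move=> pA dy dxy; rewrite -(addrK y x); exact: domB. Qed.

Lemma domZK A t x : psd A -> t != 0 -> dom A (t%:C *: x) -> dom A x.
Proof.
move=> pA t0 /(domZ t^-1 pA); rewrite scalerA -rmorphM /= mulVf //.
by rewrite rmorph1 scale1r.
Qed.

Lemma fconj0 A : psd A -> fconj A 0 = 0.
Proof.
move=> pA; apply/le_anti; rewrite fconj_ge0 ?andbT; [|by case: pA|exact: dom0].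
by apply: conj_le_fconj => y; rewrite rdot0r mulr0 sub0r oppr_le0; case: pA.
Qed.

Lemma fconjZ A t x : psd A -> dom A x -> fconj A (t%:C *: x) = t ^+ 2 * fconj A x.
Proof.
move=> pA dx; have [->|t0] := eqVneq t 0.
  by rewrite scale0r fconj0 // expr0n mul0r.
apply/le_anti/andP; split; first by apply/conj_le_fconj/conj_leZ => //; exact: fconj_ub.
have dt := domZ t pA dx.
have := conj_le_fconj (conj_leZ t^-1 pA (fconj_ub dt)).
rewrite scalerA -rmorphM /= mulVf // rmorph1 scale1r.
have t2 : 0 < t ^+ 2 by rewrite exprn_even_gt0.
by rewrite -(ler_pM2l t2) mulrA -exprMn divff // expr1n mul1r.
Qed.

Lemma parallelogram_le A x y : psd A -> dom A x -> dom A y ->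
  fconj A (x + y) + fconj A (x - y) <= 2 * fconj A x + 2 * fconj A y.
Proof.
move=> pA dx dy.
have ? := domD pA dx dy; have ? := domB pA dx dy.
rewrite -lerBrDr; apply/fconj_leP => // u.
rewrite lerBrDr -lerBrDl; apply/fconj_leP => // v.
by rewrite lerBrDl; exact: conj_le_sum.
Qed.

(** The inequality applied to [x + y] and [x - y] is its own converse. *)
Lemma parallelogram A x y : psd A -> dom A x -> dom A y ->
  fconj A (x + y) + fconj A (x - y) = 2 * fconj A x + 2 * fconj A y.
Proof.
move=> pA dx dy; apply/le_anti; rewrite parallelogram_le //=.
have := parallelogram_le pA (domD pA dx dy) (domB pA dx dy).
have -> : x + y + (x - y) = (2%:C) *: x.
  by rewrite addrACA subrr addr0 rmorph_nat -mulr2n -scaler_nat.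
have -> : x + y - (x - y) = (2%:C) *: y.
  by rewrite opprB addrC addrA subrK rmorph_nat -mulr2n -scaler_nat.
rewrite !fconjZ //; lra.
Qed.

Lemma fconj_gt0 A x : psd A -> (forall y, qf A y <= rdot y y) -> dom A x -> x != 0 ->
  0 < fconj A x.
Proof.
move=> [sA pA] lA dx x0; have := fconj_ub dx x.
by apply: lt_le_trans; have := lA x; have := rdot_gt0 x0; lra.
Qed.

(** An additive function that vanishes at 1 is periodic with period 1, so a
bound below on the unit interval is a bound everywhere; additivity rules
this out unless the function is 0. *)
Lemma additive_lb (f : R -> R) (c : R) :
  (forall s t, f (s + t) = f s + f t) ->
  (forall t, - c * (1 + t ^+ 2) <= f t) -> f 1 = 0 -> forall t, f t = 0.
Proof.
move=> fD fb f1.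
have f0 : f 0 = 0 by have := fD 0 0; rewrite addr0; lra.
have fN t : f (- t) = - f t by have := fD t (- t); rewrite subrr f0; lra.
have fn t n : f (t *+ n) = f t *+ n.
  by elim: n => [|n IH]; rewrite ?mulr0n // !mulrS fD IH.
have fz (k : int) : f k%:~R = 0.
  case: k => k; first by rewrite -pmulrn fn f1 mul0rn.
  by rewrite NegzE mulrNz fN -pmulrn fn f1 mul0rn oppr0.
have c0 : 0 <= c by have := fb 0; rewrite f0 expr0n /=; lra.
have lb t : - c * 2 <= f t.
  have -> : f t = f (t - (Num.floor t)%:~R) by rewrite fD fN fz subr0.
  apply: le_trans (fb _); rewrite !mulNr lerN2 ler_wpM2l //.
  have := Num.Theory.floor_le t; have := Num.Theory.floorD1_gt t; rewrite intrD.
  set k := (Num.floor t)%:~R => h1 h2.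
  have : (t - k) ^+ 2 <= 1 by rewrite expr_le1 //; lra.
  lra.
have ge0 t : 0 <= f t.
  rewrite leNgt; apply/negP => ft.
  have d0 : 0 <= c * 2 / - f t by rewrite divr_ge0 ?mulr_ge0 // oppr_ge0 ltW.
  have := archi_boundP d0; set n := Num.bound _.
  rewrite ltr_pdivrMr ?oppr_gt0 // => h.
  have := lb (t *+ n); rewrite fn -mulr_natl; lra.
by move=> t; have := ge0 t; have := ge0 (- t); rewrite fN; lra.
Qed.

(** Jordan and von Neumann's argument along a real line: once its quadratic
part is removed, the conjugate satisfies Jensen's equation, hence is affine
by [additive_lb].  Nonnegativity of the conjugate replaces continuity. *)
Lemma fconj_line A x p : psd A -> dom A x -> dom A p ->
  exists b, forall t, fconj A (x + t%:C *: p) = fconj A x + b * t + fconj A p * t ^+ 2.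
Proof.
move=> pA dx dp; have sA : rsym A by case: pA.
pose phi t := fconj A (x + t%:C *: p).
have dphi t : dom A (x + t%:C *: p) by apply: domD => //; exact: domZ.
have phi0 : phi 0 = fconj A x by rewrite /phi scale0r addr0.
have phi_ge0 t : 0 <= phi t by exact: fconj_ge0.
have phiP t h : phi (t + h) + phi (t - h) = 2 * phi t + 2 * (h ^+ 2 * fconj A p).
  have := parallelogram pA (dphi t) (domZ h pA dp).
  by rewrite fconjZ // /phi rmorphB rmorphD /= scalerBl scalerDl !addrA.
pose psi t := phi t - t ^+ 2 * fconj A p - phi 0.
have psiJ s t : psi s + psi t = psi (s + t).
  have e1 := phiP ((s + t) / 2) ((s - t) / 2).
  have e2 := phiP ((s + t) / 2) ((s + t) / 2).
  have a1 : (s + t) / 2 + (s - t) / 2 = s by field.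
  have a2 : (s + t) / 2 - (s - t) / 2 = t by field.
  have a3 : (s + t) / 2 + (s + t) / 2 = s + t by field.
  rewrite a1 a2 in e1; rewrite a3 subrr in e2.
  by rewrite /psi; lra.
(* The slope is read off at 1, so that the rest vanishes at 0 and at 1. *)
exists (psi 1) => t.
suff : psi t - t * psi 1 = 0 by rewrite /psi -/(phi t) phi0; lra.
pose c := fconj A p + phi 0 + `|psi 1|.
apply: (@additive_lb (fun t => psi t - t * psi 1) c) => [s u|u|].
- by rewrite -psiJ; ring.
- have := phi_ge0 u; have := phi_ge0 0; have := fconj_ge0 sA dp.
  have := sqr_ge0 u; have := sqr_ge0 (u - 1); have := sqr_ge0 (u + 1).
  have /ler_normlP[] := lexx `|psi 1|.
  by rewrite /c /psi; nra.
- by rewrite mul1r subrr.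
Qed.

(** With [x = A y] the supremum in the conjugate is attained at [y], because
[qf A] is nonnegative at [z - y]. *)
Lemma conj_le_image A y : psd A -> conj_le A (A y) (qf A y).
Proof.
move=> [sA pA] z; have := pA (z - y); rewrite qfD // qfN // !rdotE.
have [_ _ aS] := sA; rewrite aS; lra.
Qed.

Lemma dom_image A y : psd A -> dom A (A y).
Proof. by move=> /conj_le_image/conj_le_dom; exact. Qed.

(** Conjugation is an order-reversing involution; testing at the points
[A y] is all of the biconjugate theorem that is used. *)
Lemma fconj_le_qf A B c : 0 < c -> psd A ->
  (forall x, dom A x -> dom B x /\ fconj B x <= c * fconj A x) ->
  psd B -> forall y, qf A y <= c * qf B y.
Proof.
move=> c0 pA h pB y; have [d1 h1] := h _ (dom_image y pA).
have h2 := conj_le_fconj (conj_le_image y pA).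
have /fconj_leP /(_ (c%:C *: y)) := le_trans h1 (ler_wpM2l (ltW c0) h2).
move=> /(_ d1); rewrite qfZ; last by case: pB.
have [_ _ aS] := pA.1; rewrite rdotZl -aS -/(qf A y) => h3.
by rewrite -(ler_pM2l c0); lra.
Qed.

Lemma rsym_qf_eq A B c : rsym A -> rsym B -> (forall x, qf A x = c * qf B x) ->
  forall x, A x = c%:C *: B x.
Proof.
move=> sA sB h x; apply: rdot_inj => z; rewrite rdotZl.
by have := h (x + z); rewrite !qfD // !h; lra.
Qed.

End Conjugate.

(** * Scalars, orthogonal decomposition and null vectors *)

Section RankOne.
Variables (R : realType) (H : hilbertType R).
Implicit Types (x y z : H) (s t m : R) (c : R[i]) (A B C E F G : H -> H).

Definition normsq c : R := complex.Re c ^+ 2 + complex.Im c ^+ 2.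

Lemma normsqE c : (normsq c)%:C = `|c| ^+ 2.
Proof. by rewrite /normsq add_Re2_Im2. Qed.

Lemma normsq_ge0 c : 0 <= normsq c.
Proof. by rewrite addr_ge0 ?sqr_ge0. Qed.

Lemma normsqM c d : normsq (c * d) = normsq c * normsq d.
Proof. by case: c => a b; case: d => a' b'; rewrite /normsq /=; ring. Qed.

Lemma normsqR t : normsq t%:C = t ^+ 2.
Proof. by rewrite /normsq /= expr0n addr0. Qed.

Lemma rdot_normsq x y : rdot y x ^+ 2 <= normsq (inner y x).
Proof. by rewrite /normsq lerDl sqr_ge0. Qed.

Lemma innerZr c x y : inner x (c *: y) = (c^*)%C * inner x y.
Proof. by rewrite linearZr_LR. Qed.

Lemma innerZl c x y : inner (c *: x) y = c * inner x y.
Proof. by rewrite linearZl_LR. Qed.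

Lemma effectZ A c x : effects A -> A (c *: x) = c *: A x.
Proof.
move=> eA; have [[lA _] _ _ _] := eA.
have := lA c x 0; rewrite !addr0 => ->.
by rewrite rsym0 ?addr0 //; exact: effects_rsym.
Qed.

Lemma effects_psd A : effects A -> psd A.
Proof. by move=> eA; split; [exact: effects_rsym | by move/effectsP: eA => []]. Qed.

Lemma effects_le A : effects A -> forall x, qf A x <= rdot x x.
Proof. by move/effectsP => []. Qed.

Lemma effect_qfZ A c x : effects A -> qf A (c *: x) = normsq c * qf A x.
Proof.
move=> eA; rewrite /qf effectZ // /rdot innerZl innerZr mulrA.
have [_ sA _ _] := eA; have := self_adjoint_qf x sA.
by case: (inner (A x) x) => a b [_ <-]; case: c => u v; rewrite /normsq /=; ring.
Qed.

Lemma rdotZ c x : rdot (c *: x) (c *: x) = normsq c * rdot x x.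
Proof.
rewrite /rdot innerZl innerZr mulrA.
have := rdotxx x; rewrite /rdot; case: (inner x x) => a b [<-].
by case: c => u v; rewrite /normsq /=; ring.
Qed.

Lemma discriminant_null (a b : R) : 0 <= b ->
  (forall s, 0 <= 2 * s * a + s ^+ 2 * b) -> a = 0.
Proof.
move=> b0 /(_ (- a / (b + 1))).
have b1 : b + 1 != 0 by rewrite gt_eqF //; lra.
have -> : 2 * (- a / (b + 1)) * a + (- a / (b + 1)) ^+ 2 * b =
  - (a ^+ 2 * ((b + 2) / (b + 1) ^+ 2)) by field.
rewrite oppr_ge0 pmulr_lle0; last by rewrite divr_gt0 ?exprn_gt0 //; lra.
move=> h; apply/eqP; rewrite -sqrf_eq0; apply/eqP/le_anti.
by rewrite h sqr_ge0.
Qed.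

(** A zero of a nonnegative quadratic form is a critical point of it. *)
Lemma psd_null A x : psd A -> qf A x = 0 -> A x = 0.
Proof.
move=> [sA pA] q0; apply: rdot_inj => z; rewrite rdot0l.
apply: (@discriminant_null _ (qf A z)) => // s.
have := pA (x + s%:C *: z); rewrite qfD // q0 qfZ // !rdotE; lra.
Qed.

Definition proj_coef x y : R[i] := inner y x / inner x x.

Lemma normsq_proj_coef x y : x != 0 ->
  normsq (proj_coef x y) = normsq (inner y x) / rdot x x ^+ 2.
Proof.
move=> x0; have r0 := rdot_gt0 x0.
rewrite /proj_coef -rdotxx -fmorphV normsqM normsqR -exprVn //.
Qed.

Lemma proj_orth x y : x != 0 -> inner (y - proj_coef x y *: x) x = 0.
Proof.
move=> x0; rewrite linearBl /= innerZl /proj_coef divfK ?subrr //.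
by rewrite -rdotxx fmorph_eq0 gt_eqF // rdot_gt0.
Qed.

Lemma rdot_pythagoras c x w : inner w x = 0 ->
  rdot (c *: x + w) (c *: x + w) = normsq c * rdot x x + rdot w w.
Proof.
move=> o; have ow : rdot w (c *: x) = 0 by rewrite /rdot innerZr o mulr0.
by rewrite rdotDl !rdotDr rdotZ (rdotC _ w) ow addr0 add0r.
Qed.

Lemma cauchy_schwarz x y : normsq (inner y x) <= rdot x x * rdot y y.
Proof.
have [->|x0] := eqVneq x 0.
  by rewrite linear0r rdot0l mul0r /normsq /= expr0n addr0.
have r0 := rdot_gt0 x0.
have := rdot_pythagoras (proj_coef x y) (proj_orth y x0).
rewrite addrC subrK normsq_proj_coef // => ->.
set w := y - _; have w0 := rdot_ge0 w; rewrite mulrDr.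
rewrite [X in X <= _](_ : _ = rdot x x * (normsq (inner y x) / rdot x x ^+ 2 * rdot x x)).
  by rewrite lerDl mulr_ge0 // ltW.
by field; rewrite gt_eqF.
Qed.

(** * Rank-one operators *)

Definition rank1 x t : H -> H := fun y => (t%:C * inner y x) *: x.

Lemma qf_rank1 x t y : qf (rank1 x t) y = t * normsq (inner y x).
Proof.
rewrite /qf /rank1 /rdot innerZl (innerC x y).
by case: (inner y x) => a b; rewrite /normsq /=; ring.
Qed.

Lemma rank1_linear x t : linear (rank1 x t).
Proof.
by move=> c y z; rewrite /rank1 linearDl /= innerZl scalerA mulrDr scalerDl mulrCA.
Qed.

Lemma rank1_bounded x t : bounded_operator (rank1 x t).
Proof.
split; first exact: rank1_linear.
exists (`|t| * rdot x x) => y; rewrite /rank1 normrZ normrM.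
have -> : `|t%:C : R[i]| = `|t|%:C by rewrite normc_def /= expr0n addr0 sqrtr_sqr.
rewrite rmorphM /= rdotxx innerxx -!mulrA ler_wpM2l ?ler0c //.
rewrite mulrC ler_wpM2l //.
rewrite -(@ler_pXn2r _ 2) ?nnegrE ?mulr_ge0 // -normsqE exprMn -!innerxx -!rdotxx.
by rewrite -rmorphM /= lecR cauchy_schwarz.
Qed.

Lemma rank1_self_adjoint x t : self_adjoint (rank1 x t).
Proof.
move=> y z; rewrite /rank1 innerZl innerZr (innerC x z).
case: (inner y x) => a b; case: (inner z x) => u v.
by apply/eqP; rewrite eq_complex /=; apply/andP; split; apply/eqP; ring.
Qed.

Lemma rank1_finite x t : finite_rank (rank1 x t).
Proof.
exists 1%N, (fun=> x) => y; exists (fun=> t%:C * inner y x).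
by rewrite big_ord1.
Qed.

Lemma rank1_effects x t : 0 <= t ->
  (forall y, t * normsq (inner y x) <= rdot y y) -> effects (rank1 x t).
Proof.
move=> t0 h; apply/effectsP; split.
- exact: rank1_bounded.
- exact: rank1_self_adjoint.
- by move=> y; rewrite qf_rank1 mulr_ge0 // normsq_ge0.
- by move=> y; rewrite qf_rank1.
Qed.

(** * Sums, multiples and complements of effects *)

Lemma bounded_operatorD A B :
  bounded_operator A -> bounded_operator B -> bounded_operator (A + B).
Proof.
move=> [lA [M hM]] [lB [N hN]]; split.
  move=> c x y; rewrite -![(A + B) _]/(A _ + B _) lA lB scalerDr.
  by rewrite addrACA.
exists (M + N) => x; rewrite -![(A + B) _]/(A _ + B _).
by rewrite rmorphD mulrDl (le_trans (ler_normD _ _)) // lerD.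
Qed.

Lemma bounded_operatorZ A c : bounded_operator A -> bounded_operator (c *: A).
Proof.
move=> [lA [M hM]]; split.
  move=> d x y; rewrite -![(c *: A) _]/(c *: A _) lA scalerDr !scalerA.
  by rewrite (mulrC c).
have nc : `|c| = (complex.Re `|c|)%:C by rewrite RRe_real ?normr_real.
exists (complex.Re `|c| * M) => x; rewrite -![(c *: A) _]/(c *: A _) normrZ nc.
by rewrite rmorphM -mulrA ler_wpM2l // -nc.
Qed.

Lemma bounded_operatorN A : bounded_operator A -> bounded_operator (- A).
Proof. by move=> /(bounded_operatorZ (-1)); rewrite scaleN1r. Qed.

Lemma bounded_operator_id : bounded_operator (idfun : H -> H).
Proof. by split=> //; exists 1 => x; rewrite mul1r. Qed.

Lemma self_adjointD A B : self_adjoint A -> self_adjoint B -> self_adjoint (A + B).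
Proof.
move=> sA sB x y; rewrite -![(A + B) _]/(A _ + B _).
by rewrite linearDl linearDr /= sA sB.
Qed.

Lemma self_adjointZ A t : self_adjoint A -> self_adjoint (t%:C *: A).
Proof.
move=> sA x y; rewrite -![(_ *: A) _]/(_ *: A _).
by rewrite innerZl innerZr conjc_real sA.
Qed.

Lemma self_adjointN A : self_adjoint A -> self_adjoint (- A).
Proof. by move=> /(self_adjointZ (-1)); rewrite rmorphN1 scaleN1r. Qed.

Lemma qfDop A B x : qf (A + B) x = qf A x + qf B x.
Proof. by rewrite /qf -[(A + B) _]/(A _ + B _) rdotDl. Qed.

Lemma qfNop A x : qf (- A) x = - qf A x.
Proof. by rewrite /qf -[(- A) _]/(- A _) rdotNl. Qed.

Lemma qfZop A t x : qf (t%:C *: A) x = t * qf A x.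
Proof. by rewrite /qf -[(_ *: A) _]/(_ *: A _) rdotZl. Qed.

Lemma qf_id x : qf idfun x = rdot x x. Proof. by []. Qed.

Lemma qf_perp A x : qf (perp A) x = rdot x x - qf A x.
Proof. by rewrite /perp qfDop qfNop qf_id. Qed.

Lemma effectsW A : effects A -> bounded_operator A /\ self_adjoint A.
Proof. by case. Qed.

Lemma perp_effects A : effects A -> effects (perp A).
Proof.
move=> eA; have [bA sA] := effectsW eA; apply/effectsP; split.
- by apply: bounded_operatorD; [exact: bounded_operator_id|exact: bounded_operatorN].
- by apply: self_adjointD => //; exact: self_adjointN.
- by move=> x; rewrite qf_perp subr_ge0 effects_le.
- by move=> x; rewrite qf_perp lerBlDr lerDl; have [] := effects_psd eA.
Qed.

Lemma perpK A : perp (perp A) = A.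
Proof. by rewrite /perp opprB addrC subrK. Qed.

(** * Strength of an effect along a vector *)

(** For [x != 0] the largest [t] such that [rank1 x t] is below [A]
(see [strengthP]):
the reciprocal of the conjugate, read as 0 where the conjugate is infinite. *)
Definition strength A x : R := if `[< dom A x >] then (fconj A x)^-1 else 0.

Lemma strength_out A x : ~ dom A x -> strength A x = 0.
Proof. by rewrite /strength; case: asboolP. Qed.

Lemma strength_in A x : dom A x -> strength A x = (fconj A x)^-1.
Proof. by rewrite /strength; case: asboolP. Qed.

Lemma strength_ge0 A x : effects A -> 0 <= strength A x.
Proof.
move=> eA; rewrite /strength; case: asboolP => // d.
by rewrite invr_ge0 fconj_ge0 //; exact: effects_rsym.
Qed.

Lemma fconj_gt0_effect A x : effects A -> dom A x -> x != 0 -> 0 < fconj A x.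
Proof. by move=> eA; apply: fconj_gt0; [exact: effects_psd|exact: effects_le]. Qed.

Lemma strength_gt0 A x : effects A -> x != 0 -> dom A x <-> 0 < strength A x.
Proof.
move=> eA x0; rewrite /strength; case: asboolP => d; last by rewrite ltxx.
by rewrite invr_gt0 fconj_gt0_effect.
Qed.

(** The inequality [t * rdot y x ^+ 2 <= qf A y] for all [y] is the one that
defines the conjugate, optimised over the real multiples of [y]. *)
Lemma strength_rdotP A x t : effects A -> x != 0 -> 0 <= t ->
  (forall y, t * rdot y x ^+ 2 <= qf A y) <-> t <= strength A x.
Proof.
move=> eA x0; rewrite le_eqVlt => /orP[/eqP<-|t0].
  split=> _; first exact: strength_ge0.
  by move=> y; rewrite mul0r; have [] := effects_psd eA.
split=> [h|].
  have c : conj_le A x t^-1.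
    move=> y; have := h y; set r := rdot y x => hy.
    have : 0 <= (t * r - 1) ^+ 2 / t by rewrite divr_ge0 ?sqr_ge0 // ltW.
    have -> : (t * r - 1) ^+ 2 / t = t * r ^+ 2 - 2 * r + t^-1 by field; rewrite gt_eqF.
    lra.
  have d := conj_le_dom c; rewrite strength_in //.
  rewrite -[t]invrK lef_pV2 ?posrE ?invr_gt0 ?fconj_gt0_effect //.
  exact: conj_le_fconj.
have pA := effects_psd eA.
rewrite /strength; case: asboolP => [d|_]; last by rewrite leNgt t0.
have f0 := fconj_gt0_effect eA d x0 => h y.
have h' : fconj A x <= t^-1 by rewrite -[fconj A x]invrK lef_pV2 ?posrE ?invr_gt0.
have [->|k0] := eqVneq (rdot y x) 0.
  by rewrite expr0n mulr0; have [] := pA.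
(* The multiple of [y] at which the supremum is largest when equality holds. *)
move: h' => /(fconj_leP _ d)/(_ ((t * rdot y x)^-1%:C *: y)).
rewrite qfZ; last by case: pA.
rewrite rdotZl => h2.
have tk : 0 < t ^+ 2 * rdot y x ^+ 2 by rewrite mulr_gt0 // exprn_even_gt0 //= gt_eqF.
have := ler_wpM2l (ltW tk) h2.
have -> : t ^+ 2 * rdot y x ^+ 2 *
    (2 * ((t * rdot y x)^-1 * rdot y x) - (t * rdot y x)^-1 ^+ 2 * qf A y)
  = 2 * (t * rdot y x ^+ 2) - qf A y by field; rewrite k0 gt_eqF.
have -> : t ^+ 2 * rdot y x ^+ 2 * t^-1 = t * rdot y x ^+ 2 by field; rewrite gt_eqF.
lra.
Qed.

(** Multiplying [y] by the conjugate of [inner y x] makes the inner product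
real, so that the real statement gives the complex one. *)
Lemma strengthP A x t : effects A -> x != 0 -> 0 <= t ->
  (forall y, t * normsq (inner y x) <= qf A y) <-> t <= strength A x.
Proof.
move=> eA x0 t0; rewrite -strength_rdotP //; split=> h y.
  by apply: le_trans (h y); rewrite ler_wpM2l // rdot_normsq.
have := h ((inner y x)^*%C *: y); rewrite effect_qfZ //.
have -> : normsq (inner y x)^*%C = normsq (inner y x).
  by case: (inner y x) => a b; rewrite /normsq /= sqrrN.
have -> : rdot ((inner y x)^*%C *: y) x = normsq (inner y x).
  by rewrite /rdot innerZl; case: (inner y x) => a b; rewrite /normsq /=; ring.
have := normsq_ge0 (inner y x); rewrite le_eqVlt => /orP[/eqP<- _|n0].
  by rewrite mulr0; have [] := effects_psd eA.
by rewrite expr2 mulrCA ler_pM2l.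
Qed.

(** Effects below a rank-one operator are multiples of it: they vanish on
the orthogonal complement of [x] by [psd_null]. *)
Lemma qf_le_rank1 G x t : effects G -> x != 0 ->
  (forall y, qf G y <= t * normsq (inner y x)) ->
  forall y, qf G y = qf G x / rdot x x ^+ 2 * normsq (inner y x).
Proof.
move=> eG x0 h y; have pG := effects_psd eG; have [sG gG] := pG.
have o := proj_orth y x0; have n := normsq_proj_coef y x0.
set c := proj_coef x y in o n; set w := y - _ in o.
have w0 : qf G w = 0.
  by apply/le_anti; rewrite gG andbT (le_trans (h w)) // o /normsq /= expr0n addr0 mulr0.
have Gw := psd_null pG w0.
have -> : y = c *: x + w by rewrite addrC subrK.
rewrite qfD // w0 addr0; have [_ _ ->] := sG; rewrite Gw rdot0r mulr0 addr0.
rewrite effect_qfZ // n linearDl /= innerZl o addr0 /c /proj_coef.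
by rewrite divfK; [ring|rewrite -rdotxx fmorph_eq0 gt_eqF // rdot_gt0].
Qed.

(** In a decomposition that witnesses coexistence both summands of the
rank-one operator have rank one; one of them lies below [A], the other one
below [perp A].  Conversely [t] can be split according to the two
strengths. *)
Lemma coexistent_rank1 A x t : effects A -> x != 0 -> 0 <= t ->
  (effects (rank1 x t) /\ coexistent (rank1 x t) A) <->
  t <= strength A x + strength (perp A) x.
Proof.
move=> eA x0 t0; have eP := perp_effects eA; have r0 := rdot_gt0 x0; split.
  move=> [eT [E [F [G [[eE eF eG] [eTE eAE eS]]]]]].
  have qT y : qf E y + qf G y = t * normsq (inner y x).
    by rewrite -qf_rank1 eTE qfDop.
  have E0 y : 0 <= qf E y by have [] := effects_psd eE.
  have F0 y : 0 <= qf F y by have [] := effects_psd eF.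
  have G0 y : 0 <= qf G y by have [] := effects_psd eG.
  have qE := @qf_le_rank1 E x t eE x0.
  have qG := @qf_le_rank1 G x t eG x0.
  set e := qf E x / rdot x x ^+ 2 in qE; set g := qf G x / rdot x x ^+ 2 in qG.
  have e0 : 0 <= e by rewrite divr_ge0 ?sqr_ge0.
  have g0 : 0 <= g by rewrite divr_ge0 ?sqr_ge0.
  have -> : t = g + e.
    have := qT x; rewrite qE ?qG; try by move=> y; rewrite -qT ?lerDl ?lerDr.
    have nx : normsq (inner x x) != 0.
      by rewrite -rdotxx normsqR expf_neq0 // gt_eqF.
    by rewrite -mulrDl => /(mulIf nx) <-; rewrite addrC.
  apply: lerD; apply/strengthP => // y.
    rewrite -qG; last by move=> z; rewrite -qT lerDr.
    by rewrite eAE qfDop lerDr.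
  rewrite -qE; last by move=> z; rewrite -qT lerDl.
  rewrite qf_perp lerBrDr eAE -qfDop.
  by have := effects_le eS y; rewrite addrA.
move=> tle.
(* As much as possible is put below [A]; the rest then fits below [perp A]. *)
pose g := Num.min t (strength A x); pose e := t - g.
have g0 : 0 <= g by rewrite le_min t0 strength_ge0.
have e0 : 0 <= e by rewrite subr_ge0 ge_min lexx.
have /strengthP gA : g <= strength A x by rewrite ge_min lexx orbT.
have /strengthP eB : e <= strength (perp A) x.
  rewrite /e /g; case: (leP t (strength A x)) => _; last by rewrite lerBlDl.
  by rewrite subrr strength_ge0.
have {}gA y := gA eA x0 g0 y; have {}eB y := eB eP x0 e0 y.
have teg : t = e + g by rewrite subrK.
have q2 y : qf A y + qf (perp A) y = rdot y y by rewrite qf_perp addrC subrK.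
have A0 y : 0 <= qf A y by have [] := effects_psd eA.
have P0 y : 0 <= qf (perp A) y by have [] := effects_psd eP.
have n0 y := normsq_ge0 (inner y x).
have rD : rank1 x t = rank1 x e + rank1 x g.
  by apply/funext => y; rewrite /rank1 teg rmorphD /= mulrDl scalerDl.
have [bA sA] := effectsW eA.
split.
  by apply: rank1_effects => // y; have := gA y; have := eB y; rewrite -q2 teg; lra.
exists (rank1 x e), (A - rank1 x g), (rank1 x g); split; split.
- by apply: rank1_effects => // y; have := A0 y; have := eB y; rewrite -q2; lra.
- apply/effectsP; split.
  + by apply: bounded_operatorD => //; apply: bounded_operatorN; exact: rank1_bounded.
  + by apply: self_adjointD => //; apply: self_adjointN; exact: rank1_self_adjoint.
  + by move=> y; rewrite qfDop qfNop qf_rank1 subr_ge0.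
  + move=> y; rewrite qfDop qfNop qf_rank1 -q2; have := P0 y.
    by have := mulr_ge0 g0 (n0 y); lra.
- by apply: rank1_effects => // y; have := P0 y; have := gA y; rewrite -q2; lra.
- exact: rD.
- by rewrite subrK.
- rewrite -addrA subrK; apply/effectsP; split.
  + by apply: bounded_operatorD => //; exact: rank1_bounded.
  + by apply: self_adjointD => //; exact: rank1_self_adjoint.
  + by move=> y; rewrite qfDop qf_rank1 addr_ge0 // mulr_ge0.
  + by move=> y; rewrite qfDop qf_rank1 -q2; have := eB y; lra.
Qed.

End RankOne.

(** * Quadratic polynomials in one real variable *)

Section Poly.
Variable R : realType.
Implicit Types (p q r : {poly R}).

(** Working near infinity lets finitely many exceptional parameters be
discarded with filter reasoning. *)
Lemma poly_neq0_near p : p != 0 -> \forall t \near +oo, p.[t] != 0.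
Proof.
move=> p0; exists (cauchy_bound p); split; first exact: num_real.
move=> t ht; apply: contraTneq ht => /(cauchy_boundP p0) h.
by rewrite -leNgt (le_trans (ler_norm _)) // ltW.
Qed.

Lemma poly_eq_near p q : (\forall t \near +oo, p.[t] = q.[t]) -> p = q.
Proof.
move=> h; apply/eqP; rewrite -subr_eq0; apply/negP => /negP/poly_neq0_near h'.
have [t []] := filter_ex (filterI h h').
by rewrite !hornerE => ->; rewrite subrr eqxx.
Qed.

Lemma irreducible_dvdM p q r : irreducible_poly p -> p %| q * r -> p %| q \/ p %| r.
Proof.
move=> ip; have [cpq|ncpq] := boolP (coprimep p q); first by rewrite Gauss_dvdpr //; right.
move=> _; left; have e := ip (gcdp p q) ncpq (dvdp_gcdl p q).
by rewrite -(eqp_dvdl _ e) dvdp_gcdr.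
Qed.

Definition quad (a b c : R) : {poly R} := a%:P + b *: 'X + c *: 'X^2.

Lemma quadE (a b c t : R) : (quad a b c).[t] = a + b * t + c * t ^+ 2.
Proof. by rewrite /quad !hornerE. Qed.

Lemma coef_quad (a b c : R) : ((quad a b c)`_0 = a) * ((quad a b c)`_2 = c).
Proof.
by rewrite /quad !coefD !coefC !coefZ !coefX !coefXn /= !mulr0 !mulr1 !addr0 !add0r.
Qed.

Lemma size_quad_le (a b c : R) : (size (quad a b c) <= 3)%N.
Proof.
rewrite /quad (leq_trans (size_polyD _ _)) // geq_max.
rewrite (leq_trans (size_polyD _ _)) ?geq_max.
  by rewrite (leq_trans (size_scale_leq _ _)) ?size_polyXn.
rewrite (leq_trans (size_scale_leq _ _)) ?size_polyX //.
by rewrite (leq_trans (size_polyC_leq1 _)).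
Qed.

Lemma size_quad (a b c : R) : c != 0 -> size (quad a b c) = 3%N.
Proof.
move=> c0; apply/eqP; rewrite eqn_leq size_quad_le /=.
by rewrite ltnNge; apply: contra c0 => /leq_sizeP/(_ 2%N (leqnn _)); rewrite coef_quad => ->.
Qed.

Lemma dvd_quad (a b c a' b' c' : R) : c != 0 ->
  quad a b c %| quad a' b' c' -> a * c' = a' * c.
Proof.
move=> c0 /dvdpP[k e].
have : (size k <= 1)%N.
  have [->|k0] := eqVneq k 0; first by rewrite size_poly0.
  have q0 : quad a b c != 0 by rewrite -size_poly_eq0 size_quad.
  have := size_quad_le a' b' c'; rewrite e size_mul // size_quad //.
  by case: (size k) => [|[|n]] //=; rewrite !addnS.
move/size1_polyC => kE; rewrite kE mul_polyC in e.
have e0 := congr1 (fun p : {poly R} => p`_0) e; have e2 := congr1 (fun p : {poly R} => p`_2) e.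
by rewrite !coefZ !coef_quad in e0 e2; rewrite e0 e2; ring.
Qed.

(** After clearing denominators [a] divides [b * c * d], and it is
irreducible. *)
Lemma harmonic_dvd (a b c d : {poly R}) : irreducible_poly a ->
  (forall t, [/\ 0 < a.[t], 0 < b.[t], 0 < c.[t] & 0 < d.[t]]) ->
  (forall t, a.[t]^-1 + b.[t]^-1 = c.[t]^-1 + d.[t]^-1) ->
  [\/ a %| b, a %| c | a %| d].
Proof.
move=> irr pos eqt.
have e : b * c * d = a * (b * (c + d) - c * d).
  apply: poly_eq_near; apply: nearW => t; have := eqt t; have [] := pos t.
  rewrite !hornerE => pa pb pc pd h.
  have : (a.[t] * b.[t] * c.[t] * d.[t]) * (a.[t]^-1 + b.[t]^-1)
       = (a.[t] * b.[t] * c.[t] * d.[t]) * (c.[t]^-1 + d.[t]^-1) by rewrite h.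
  have -> : (a.[t] * b.[t] * c.[t] * d.[t]) * (a.[t]^-1 + b.[t]^-1)
     = (b.[t] + a.[t]) * c.[t] * d.[t] by field; rewrite !gt_eqF.
  have -> : (a.[t] * b.[t] * c.[t] * d.[t]) * (c.[t]^-1 + d.[t]^-1)
     = a.[t] * b.[t] * (d.[t] + c.[t]) by field; rewrite !gt_eqF.
  move=> /eqP; rewrite -subr_eq0 => /eqP h2.
  by apply/eqP; rewrite -subr_eq0; apply/eqP; rewrite -[RHS]h2; ring.
have : a %| b * c * d by rewrite e dvdp_mulr.
move=> /(irreducible_dvdM irr)[/(irreducible_dvdM irr)[]|] h.
- by constructor 1.
- by constructor 2.
- by constructor 3.
Qed.

End Poly.

(** * Generic points of a real line *)

Section Generic.
Variables (R : realType) (H : hilbertType R).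
Implicit Types (x y p : H) (t : R) (P Q : H -> Prop).

(** The property holds far out on a line as soon as it holds at its base point
or in its direction.  It is the form of density that complements of
subspaces and of zero sets of quadratic forms share. *)
Definition generic P := forall x p, P x \/ P p ->
  \forall t \near +oo, P (x + (t%:C : R[i]) *: p).

Lemma generic_inter P Q x y : generic P -> generic Q -> P x -> Q y ->
  exists z, P z /\ Q z.
Proof.
move=> gP gQ px qy.
have [t h] := filter_ex (filterI (gP x y (or_introl px)) (gQ x y (or_intror qy))).
by exists (x + t%:C *: y).
Qed.

Lemma generic_and P Q : generic P -> generic Q -> generic (fun x => P x /\ Q x).
Proof.
move=> gP gQ x p h.
have hP : P x \/ P p by case: h => -[]; [left|right].
have hQ : Q x \/ Q p by case: h => -[]; [left|right].
exact: filterI (gP _ _ hP) (gQ _ _ hQ).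
Qed.

End Generic.

(** * Effects with an infinite conjugate value *)

Section Analysis.
Variables (R : realType) (H : hilbertType R).
Implicit Types (x y z p : H) (s t : R) (A B C D : H -> H).

(** A line that meets the subspace [dom A] twice lies in it. *)
Lemma dom_generic A : psd A -> generic (fun x => ~ dom A x).
Proof.
move=> pA x p h; have [dp|ndp] := pselect (dom A p).
  apply: nearW => t dt; case: h => // dx; apply: dx.
  by apply: domK dt => //; exact: domZ.
have [[s ds]|nd] := pselect (exists t, dom A (x + t%:C *: p)); last first.
  by apply: nearW => t dt; apply: nd; exists t.
apply: filterS (nbhs_pinfty_gt (num_real s)) => t st dt; apply: ndp.
apply: (@domZK _ _ A (t - s)); rewrite ?subr_eq0 ?gt_eqF //.
have := domB pA dt ds; rewrite opprD addrACA subrr add0r.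
by rewrite rmorphB scalerBl.
Qed.

(** With [x] outside [dom B] and [y] outside [dom C], the line through [x] in
direction [y] eventually avoids both: a subspace covered by two subspaces is
contained in one of them. *)
Lemma dom_cover A B C : psd A -> psd B -> psd C ->
  (forall x, dom A x -> dom B x \/ dom C x) ->
  (forall x, dom A x -> dom B x) \/ (forall x, dom A x -> dom C x).
Proof.
move=> pA pB pC h.
have [|/existsNP[x /not_implyP[ax nbx]]] := pselect (forall x, dom A x -> dom B x).
  by left.
right=> y ay; apply: contrapT => ncy.
have hB := dom_generic pB (or_introl nbx : ~ dom B x \/ ~ dom B y).
have hC := dom_generic pC (or_intror ncy : ~ dom C x \/ ~ dom C y).
have [t [nb nc]] := filter_ex (filterI hB hC).
by have [] := h _ (domD pA ax (domZ t pA ay)).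
Qed.

(** Both sides are polynomials in the parameter of the line. *)
Lemma fconj_near A B x p : psd A -> psd B -> dom A x -> dom A p -> dom B x -> dom B p ->
  (\forall t \near +oo, fconj A (x + t%:C *: p) = fconj B (x + t%:C *: p)) ->
  fconj A x = fconj B x.
Proof.
move=> pA pB ax ap bx bp.
have [u hu] := fconj_line pA ax ap; have [v hv] := fconj_line pB bx bp.
move=> h; have : quad (fconj A x) u (fconj A p) = quad (fconj B x) v (fconj B p).
  by apply: poly_eq_near; apply: filterS h => t; rewrite !quadE hu hv.
by move=> /(congr1 (fun q : {poly R} => q`_0)); rewrite !coef_quad.
Qed.

(** By [coexistent_rank1] this function is what the rank-one effects
coexistent with [A] know about [A]. *)
Definition total_strength A x := strength A x + strength (perp A) x.
Definition same_total_strength A B :=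
  forall x, x != 0 -> total_strength A x = total_strength B x.

Lemma total_strength_perp A x : total_strength (perp A) x = total_strength A x.
Proof. by rewrite /total_strength perpK addrC. Qed.

Lemma dom_add_perp A x : effects A -> exists y z, [/\ dom A y, dom (perp A) z & x = y + z].
Proof.
move=> eA; exists (A x), (perp A x); split.
- by apply: dom_image; exact: effects_psd.
- by apply: dom_image; apply: effects_psd; exact: perp_effects.
- by rewrite /perp -[(idfun - A) x]/(x - A x) addrC subrK.
Qed.

Lemma effects_pair A : effects A -> psd A /\ psd (perp A).
Proof. by move=> eA; split; apply: effects_psd => //; exact: perp_effects. Qed.

(** Off 0 the total strength vanishes exactly where both conjugates are
infinite. *)
Lemma dom_union A B x : effects A -> effects B -> same_total_strength A B ->
  dom A x \/ dom (perp A) x -> dom B x \/ dom (perp B) x.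
Proof.
move=> eA eB sAB h; have [pA pA'] := effects_pair eA; have [pB pB'] := effects_pair eB.
have [->|x0] := eqVneq x 0; first by left; exact: dom0.
apply: contrapT => /not_orP[nb nb']; have := sAB x x0.
rewrite /total_strength (strength_out nb) (strength_out nb') addr0.
have := strength_ge0 x eA; have := strength_ge0 x (perp_effects eA).
by case: h => /strength_gt0 -/(_ _ x0); [move=> /(_ eA)|move=> /(_ (perp_effects eA))]; lra.
Qed.

Lemma qf_eq_effects A B : effects A -> effects B ->
  (forall x, qf A x = qf B x) -> A = B.
Proof.
move=> eA eB h; apply/funext => x.
have := @rsym_qf_eq _ _ A B 1 (effects_rsym eA) (effects_rsym eB).
by move=> ->; [rewrite scale1r | move=> y; rewrite mul1r].
Qed.

Lemma perp_inj A B : perp A = perp B -> A = B.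
Proof. by move=> h; rewrite -[A]perpK h perpK. Qed.

Lemma neq0_ndom A x : psd A -> ~ dom A x -> x != 0.
Proof. by move=> pA; apply: contra_notN => /eqP->; exact: dom0. Qed.

(** Outside [dom A] the total strength of [A] is the single term of
[perp A].  If some direction of [dom (perp A)] leaves both [dom A] and
[dom B], this identifies the conjugates of [perp A] and [perp B], first at
generic points and then everywhere.  Otherwise all conjugates except that of
[A] are finite on the whole space, and the identity that holds off [dom A]
extends to [dom A], where it forces the strength of [A] to be 0; then
[dom A], which contains the range of [A], is 0. *)
Lemma unbounded_case_sub A B : effects A -> effects B -> same_total_strength A B ->
  (exists w, ~ dom A w) -> (forall x, dom (perp A) x -> dom (perp B) x) ->
  B = A \/ forall x, A x = 0.
Proof.
move=> eA eB sAB [w nw] sub.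
have [pA pA'] := effects_pair eA; have [pB pB'] := effects_pair eB.
have eA' := perp_effects eA; have eB' := perp_effects eB.
have [p0 [a'p0 nap0]] : exists p, dom (perp A) p /\ ~ dom A p.
  have [y [z [ay az wyz]]] := dom_add_perp w eA; exists z; split=> // az'.
  by apply: nw; rewrite wyz; exact: domD.
have [[p [a'p [nap nbp]]]|nop] :=
    pselect (exists p, dom (perp A) p /\ (~ dom A p /\ ~ dom B p)).
  left.
  have eqN x : dom (perp A) x -> fconj (perp A) x = fconj (perp B) x.
    move=> a'x; apply: (@fconj_near _ _ x p) => //; [exact: sub|exact: sub|].
    have hA := dom_generic pA (or_intror nap : ~ dom A x \/ ~ dom A p).
    have hB := dom_generic pB (or_intror nbp : ~ dom B x \/ ~ dom B p).
    apply: filterS (filterI hA hB) => t [na nb].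
    have a'z : dom (perp A) (x + t%:C *: p) by apply: domD => //; exact: domZ.
    have := sAB _ (neq0_ndom pA na); rewrite /total_strength.
    rewrite (strength_out na) (strength_out nb).
    by rewrite !add0r !strength_in //; [exact: invr_inj|exact: sub].
  have cov : forall x, dom (perp B) x -> dom (perp A) x.
    have [|//] : (forall x, dom (perp B) x -> dom A x) \/
                 (forall x, dom (perp B) x -> dom (perp A) x).
      apply: dom_cover => // x b'x; apply: (dom_union eB eA); last by right.
      by move=> y y0; rewrite sAB.
    by move=> h; case: nap0; apply: h; exact: sub.
  apply/esym/perp_inj/qf_eq_effects => // x; apply/le_anti/andP; split.
    rewrite -[leRHS]mul1r; apply: fconj_le_qf => // y ay; split; first exact: sub.
    by rewrite mul1r eqN.
  rewrite -[leRHS]mul1r; apply: fconj_le_qf => // y b'y; split; first exact: cov.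
  by rewrite mul1r eqN //; exact: cov.
right.
have inB x : dom (perp A) x -> ~ dom A x -> dom B x.
  by move=> a'x nax; apply: contrapT => nbx; apply: nop; exists x.
have subB x : dom (perp A) x -> dom B x.
  move=> a'x; have [ax|] := pselect (dom A x); last exact: inB.
  apply: (@domK _ _ B x p0) => //; first exact: inB.
  apply: inB; first exact: domD.
  by rewrite addrC => h; apply: nap0; apply: domK h.
have BA : same_total_strength B A by move=> y y0; rewrite sAB.
have supB x : dom B x -> dom (perp A) x.
  have [h|] : (forall x, dom B x -> dom A x) \/ (forall x, dom B x -> dom (perp A) x).
  - by apply: dom_cover => // y by_; apply: (dom_union eB eA) => //; left.
  - by case: nap0; apply: h; exact: subB.
  - exact.
have supB' x : dom (perp B) x -> dom (perp A) x.
  have [h|] : (forall x, dom (perp B) x -> dom A x) \/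
              (forall x, dom (perp B) x -> dom (perp A) x).
  - by apply: dom_cover => // y by_; apply: (dom_union eB eA) => //; right.
  - by case: nap0; apply: h; exact: sub.
  - exact.
have allA' x : dom (perp A) x.
  have [y [z [hy hz ->]]] := dom_add_perp x eB.
  by apply: domD => //; [exact: supB|exact: supB'].
have domA0 x : dom A x -> x = 0.
  move=> ax; apply/eqP; apply: contrapT => /negP x0.
  have [u hu] := fconj_line pA' (allA' x) a'p0.
  have [v hv] := fconj_line pB (subB _ (allA' x)) (subB _ a'p0).
  have [v' hv'] := fconj_line pB' (sub _ (allA' x)) (sub _ a'p0).
  pose qa := quad (fconj (perp A) x) u (fconj (perp A) p0).
  pose qb := quad (fconj B x) v (fconj B p0).
  pose qb' := quad (fconj (perp B) x) v' (fconj (perp B) p0).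
  have e : qb * qb' = qa * (qb + qb').
    apply: poly_eq_near.
    have := dom_generic pA (or_intror nap0 : ~ dom A x \/ ~ dom A p0).
    apply: filterS => t na; rewrite !hornerM (hornerD qb qb') !quadE -hu -hv -hv'.
    set z := x + _ in na *; have z0 := neq0_ndom pA na.
    have := sAB _ z0; rewrite /total_strength (strength_out na) add0r !strength_in; first last.
    - exact: allA'.
    - exact: subB.
    - exact: sub.
    have ga := fconj_gt0_effect eA' (allA' z) z0.
    have gb := fconj_gt0_effect eB (subB _ (allA' z)) z0.
    have gb' := fconj_gt0_effect eB' (sub _ (allA' z)) z0.
    move=> h; apply: (mulIf (_ : (fconj (perp A) z)^-1 != 0)).
      by rewrite invr_neq0 ?gt_eqF.
    rewrite {1}h; field; by rewrite !gt_eqF.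
  have := congr1 (fun q : {poly R} => q.[0]) e.
  rewrite /= !hornerM (hornerD qb qb') !quadE !mulr0 expr0n /= !mulr0 !addr0 => h.
  have ga := fconj_gt0_effect eA' (allA' x) x0.
  have gb := fconj_gt0_effect eB (subB _ (allA' x)) x0.
  have gb' := fconj_gt0_effect eB' (sub _ (allA' x)) x0.
  have := sAB _ x0; rewrite /total_strength.
  rewrite (strength_in (allA' x)) (strength_in (subB _ (allA' x))).
  rewrite (strength_in (sub _ (allA' x))).
  have -> : (fconj B x)^-1 + (fconj (perp B) x)^-1 = (fconj (perp A) x)^-1.
    apply: (mulfI (_ : fconj B x * fconj (perp B) x != 0)).
      by rewrite mulf_neq0 ?gt_eqF.
    rewrite {2}h; field; by rewrite !gt_eqF.
  have /(strength_gt0 eA x0) := ax; lra.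
by move=> x; apply: domA0; exact: dom_image.
Qed.

(** By [dom_cover] the domain of [perp A] lies in that of [B] or of
[perp B]; exchanging [B] and [perp B] reduces to the second case. *)
Lemma unbounded_case A B : effects A -> effects B -> same_total_strength A B ->
  (exists w, ~ dom A w) -> (B = A \/ B = perp A) \/ forall x, A x = 0.
Proof.
move=> eA eB sAB nw.
have [pA pA'] := effects_pair eA; have [pB pB'] := effects_pair eB.
have [h|h] : (forall x, dom (perp A) x -> dom B x) \/
             (forall x, dom (perp A) x -> dom (perp B) x).
- by apply: dom_cover => // x a'x; apply: (dom_union eA eB) => //; right.
- have sAB' : same_total_strength A (perp B) by move=> x x0; rewrite total_strength_perp sAB.
  have [|h1|h1] := unbounded_case_sub eA (perp_effects eB) sAB' nw; first by rewrite perpK.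
  + by left; right; rewrite -[B]perpK h1.
  + by right.
- have [h1|h1] := unbounded_case_sub eA eB sAB nw h; first by left; left.
  by right.
Qed.

End Analysis.

(** * Effects with finite conjugates *)

Section Bounded.
Variables (R : realType) (H : hilbertType R).
Implicit Types (x y z p : H) (s t : R) (A B C D : H -> H) (P Q : H -> Prop).

Definition quadratic_on_lines (g : H -> R) :=
  forall x p, exists b, forall t, g (x + t%:C *: p) = g x + b * t + g p * t ^+ 2.

Lemma quadratic_generic g : quadratic_on_lines g -> generic (fun x => g x != 0).
Proof.
move=> gq x p h; have [b hb] := gq x p.
have : quad (g x) b (g p) != 0.
  apply/eqP => e; have e0 := congr1 (fun q : {poly R} => q`_0) e.
  have e2 := congr1 (fun q : {poly R} => q`_2) e.
  rewrite !coef_quad !coef0 in e0 e2.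
  by case: h; rewrite ?e0 ?e2 eqxx.
by move/poly_neq0_near; apply: filterS => t; rewrite quadE hb.
Qed.

(** Zero sets of nonzero quadratic forms are nowhere dense: with one
point off each of them, moving along lines gives a point off all. *)
Lemma quadratic_product0 (g1 g2 g3 : H -> R) :
  quadratic_on_lines g1 -> quadratic_on_lines g2 -> quadratic_on_lines g3 ->
  (forall x, [\/ g1 x = 0, g2 x = 0 | g3 x = 0]) ->
  [\/ forall x, g1 x = 0, forall x, g2 x = 0 | forall x, g3 x = 0].
Proof.
move=> /quadratic_generic q1 /quadratic_generic q2 /quadratic_generic q3 h.
have [|/existsNP[x1 /eqP h1]] := pselect (forall x, g1 x = 0); first by constructor 1.
have [|/existsNP[x2 /eqP h2]] := pselect (forall x, g2 x = 0); first by constructor 2.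
have [|/existsNP[x3 /eqP h3]] := pselect (forall x, g3 x = 0); first by constructor 3.
have [y12 h12] := generic_inter q1 q2 h1 h2.
have [z [[/eqP z1 /eqP z2] /eqP z3]] := generic_inter (generic_and q1 q2) q3 h12 h3.
by case: (h z).
Qed.

Definition bounded_dom A := forall x, dom A x.

Lemma fconj_comb_quadratic A B s t : psd A -> psd B -> bounded_dom A -> bounded_dom B ->
  quadratic_on_lines (fun x => s * fconj A x - t * fconj B x).
Proof.
move=> pA pB dA dB x p.
have [b hb] := fconj_line pA (dA x) (dA p); have [c hc] := fconj_line pB (dB x) (dB p).
by exists (s * b - t * c) => u; rewrite hb hc; ring.
Qed.

(** If the line through [p] in direction [r] avoids 0, the four conjugates
are on it positive quadratic polynomials with equal sums of reciprocals; by
[harmonic_dvd] the first one divides another one.  Only the two extreme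
coefficients, the values at [p] and at [r], are recorded. *)
Lemma fconj_prop_line A B p r : effects A -> effects B -> same_total_strength A B ->
  bounded_dom A -> bounded_dom (perp A) -> bounded_dom B -> bounded_dom (perp B) ->
  let prop C := fconj A p * fconj C r - fconj C p * fconj A r = 0 in
  [\/ prop (perp A), prop B | prop (perp B)].
Proof.
move=> eA eB sAB dA dA' dB dB' prop.
have [pA pA'] := effects_pair eA; have [pB pB'] := effects_pair eB.
have [r0|r0] := eqVneq r 0.
  by constructor 1; rewrite /prop r0 !fconj0 // !mulr0 subrr.
have [[t ht]|nt] := pselect (exists t, p + t%:C *: r = 0).
  have pE : p = (- t)%:C *: r by rewrite rmorphN scaleNr; apply/eqP; rewrite -addr_eq0 ht.
  by constructor 1; rewrite /prop pE !fconjZ //; ring.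
have [a1 ha] := fconj_line pA (dA p) (dA r).
have [b1 hb] := fconj_line pA' (dA' p) (dA' r).
have [c1 hc] := fconj_line pB (dB p) (dB r).
have [d1 hd] := fconj_line pB' (dB' p) (dB' r).
have nz t : p + t%:C *: r != 0 by apply: contra_notN nt => /eqP; exists t.
have gt0 C (eC : effects C) (dC : bounded_dom C) t : 0 < fconj C (p + t%:C *: r).
  exact: fconj_gt0_effect.
have eA' := perp_effects eA; have eB' := perp_effects eB.
have irr : irreducible_poly (quad (fconj A p) a1 (fconj A r)).
  apply: cubic_irreducible.
    by rewrite size_quad // gt_eqF // fconj_gt0_effect.
  by move=> t; rewrite /root quadE -ha gt_eqF // gt0.
have nAr : fconj A r != 0 by rewrite gt_eqF // fconj_gt0_effect.
have [||h|h|h] := @harmonic_dvd _ _ (quad (fconj (perp A) p) b1 (fconj (perp A) r))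
  (quad (fconj B p) c1 (fconj B r)) (quad (fconj (perp B) p) d1 (fconj (perp B) r)) irr.
- by move=> t; rewrite !quadE -ha -hb -hc -hd; split; exact: gt0.
- move=> t; rewrite !quadE -ha -hb -hc -hd.
  by have := sAB _ (nz t); rewrite /total_strength !strength_in.
- by constructor 1; rewrite /prop (dvd_quad nAr h) subrr.
- by constructor 2; rewrite /prop (dvd_quad nAr h) subrr.
- by constructor 3; rewrite /prop (dvd_quad nAr h) subrr.
Qed.

Definition positive_multiple A B := exists2 c : R, 0 < c & forall x, B x = c%:C *: A x.

(** Proportional conjugates come from proportional forms, by
[fconj_le_qf] in both directions. *)
Lemma fconj_prop_multiple A B p : effects A -> effects B -> p != 0 ->
  bounded_dom A -> bounded_dom B ->
  (forall x, fconj A p * fconj B x - fconj B p * fconj A x = 0) ->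
  positive_multiple A B.
Proof.
move=> eA eB p0 dA dB h; have pA := effects_psd eA; have pB := effects_psd eB.
have a0 := fconj_gt0_effect eA (dA p) p0; have b0 := fconj_gt0_effect eB (dB p) p0.
pose k := fconj A p / fconj B p; have k0 : 0 < k by rewrite divr_gt0.
exists k => //; apply: rsym_qf_eq; [exact: effects_rsym|exact: effects_rsym|].
have ek x : fconj A x = k * fconj B x.
  have /eqP := h x; rewrite subr_eq0 => /eqP hx.
  by rewrite /k mulrAC hx mulrAC divff ?mul1r // gt_eqF.
move=> x; apply/le_anti/andP; split.
  by apply: fconj_le_qf => // y _; split=> //; rewrite ek.
rewrite -ler_pdivlMl //; apply: fconj_le_qf; rewrite ?invr_gt0 // => y _; split=> //.
by rewrite ek mulrA mulVf ?mul1r // gt_eqF.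
Qed.

(** In [fconj_prop_line] the choice of the partner depends on [r].  For
fixed [p] the three alternatives are zero conditions of quadratic forms in
[r], so [quadratic_product0] makes the choice uniform. *)
Lemma bounded_multiple A B p : effects A -> effects B -> same_total_strength A B -> p != 0 ->
  bounded_dom A -> bounded_dom (perp A) -> bounded_dom B -> bounded_dom (perp B) ->
  [\/ positive_multiple A (perp A), positive_multiple A B | positive_multiple A (perp B)].
Proof.
move=> eA eB sAB p0 dA dA' dB dB'.
have eA' := perp_effects eA; have eB' := perp_effects eB.
have [pA pA'] := effects_pair eA; have [pB pB'] := effects_pair eB.
have qd C : psd C -> bounded_dom C ->
    quadratic_on_lines (fun x => fconj A p * fconj C x - fconj C p * fconj A x).
  by move=> pC dC; exact: fconj_comb_quadratic.
have [h|h|h] := quadratic_product0 (qd _ pA' dA') (qd _ pB dB) (qd _ pB' dB')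
  (fun r => fconj_prop_line p r eA eB sAB dA dA' dB dB').
- by constructor 1; exact: fconj_prop_multiple h.
- by constructor 2; exact: fconj_prop_multiple h.
- by constructor 3; exact: fconj_prop_multiple h.
Qed.

Definition homothety A := exists s, forall x, A x = s%:C *: x.

Lemma perpE A x : perp A x = x - A x. Proof. by []. Qed.

Lemma homothety_lin A s t : t != 0 -> (forall x, t%:C *: A x = s%:C *: x) -> homothety A.
Proof.
move=> t0 h; exists (t^-1 * s) => x; rewrite rmorphM -scalerA -h scalerA -rmorphM /= mulVf //.
by rewrite rmorph1 scale1r.
Qed.

Lemma multiple_perp_homothety A s t : 0 < s -> 0 < t ->
  (forall x, s%:C *: A x = t%:C *: perp A x) -> homothety A.
Proof.
move=> s0 t0 h; apply: (@homothety_lin A t (s + t)); first by rewrite gt_eqF ?addr_gt0.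
by move=> x; rewrite rmorphD scalerDl h perpE scalerBr subrK.
Qed.

(** If [B = c A] and [I - B = d (I - A)], then [(c - d) A = (1 - d) I]: either
[c = d = 1] or [A] is scalar. *)
Lemma multiple_both A B p : p != 0 -> positive_multiple A B ->
  positive_multiple (perp A) (perp B) -> B = A \/ homothety A.
Proof.
move=> p0 [c c0 hc] [d d0 hd].
have e x : (c - d)%:C *: A x = (1 - d)%:C *: x.
  have := hd x; rewrite !perpE hc scalerBr => h.
  have hx : d%:C *: x - d%:C *: A x + c%:C *: A x = x by rewrite -h subrK.
  rewrite !rmorphB !scalerBl rmorph1 scale1r.
  by apply: (addrI (d%:C *: x)); rewrite [RHS]addrC subrK addrA addrAC.
have [cd|cd] := eqVneq c d; last by right; apply: homothety_lin e; rewrite subr_eq0.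
left; apply/funext => x; rewrite hc.
have := e p; rewrite cd subrr rmorph0 scale0r => /esym/eqP.
rewrite scaler_eq0 (negbTE p0) orbF fmorph_eq0 subr_eq0 => /eqP <-.
by rewrite scale1r.
Qed.

(** [bounded_multiple] is applied to [A] and to [perp A]; whenever the two
partners coincide, [A] and [perp A] are proportional. *)
Lemma bounded_case A B p : effects A -> effects B -> same_total_strength A B -> p != 0 ->
  bounded_dom A -> bounded_dom (perp A) -> bounded_dom B -> bounded_dom (perp B) ->
  (B = A \/ B = perp A) \/ homothety A.
Proof.
move=> eA eB sAB p0 dA dA' dB dB'.
have eA' := perp_effects eA; have eB' := perp_effects eB.
have sAB' : same_total_strength (perp A) B by move=> x x0; rewrite total_strength_perp sAB.
have dA'' : bounded_dom (perp (perp A)) by rewrite perpK.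
have one (D : H -> H) : positive_multiple A D -> positive_multiple (perp A) D -> homothety A.
  move=> [c c0 hc] [d d0 hd]; apply: (multiple_perp_homothety c0 d0) => x.
  by rewrite -hc -hd.
have triv : positive_multiple A A by exists 1 => // x; rewrite scale1r.
have triv' : positive_multiple (perp A) (perp A) by exists 1 => // x; rewrite scale1r.
have := bounded_multiple eA eB sAB p0 dA dA' dB dB'.
have := bounded_multiple eA' eB sAB' p0 dA' dA'' dB dB'; rewrite perpK.
case=> [h' _|h'|h']; first by right; exact: one h'.
- case=> [h|h|h]; [by right; exact: one triv'|by right; exact: one h'|].
  have := @multiple_both A (perp B) p p0 h; rewrite perpK => /(_ h')[e|]; last by right.
  by left; right; rewrite -e perpK.
- case=> [h|h|h]; [by right; exact: one triv'| |by right; exact: one h'].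
  by have [e|] := multiple_both p0 h h'; [left; left|right].
Qed.

End Bounded.

(** * Scalar effects and the equivalence *)

Section Final.
Variables (R : realType) (H : hilbertType R).
Implicit Types (x y z p e : H) (s t : R) (A B C D : H -> H).

Lemma strength_case A B e : effects A -> effects B -> same_total_strength A B -> e != 0 ->
  (B = A \/ B = perp A) \/ (homothety A \/ homothety B).
Proof.
move=> eA eB sAB e0.
have eA' := perp_effects eA; have eB' := perp_effects eB.
have sBA : same_total_strength B A by move=> x x0; rewrite sAB.
have zero C : (forall x, C x = 0) -> homothety C.
  by move=> h; exists 0 => x; rewrite h scale0r.
have zero' C : (forall x, perp C x = 0) -> homothety C.
  move=> h; exists 1 => x; have := h x; rewrite perpE scale1r => /eqP.
  by rewrite subr_eq0 => /eqP.
have [dA|/existsNP nA] := pselect (bounded_dom A); last first.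
  by have [|/zero] := unbounded_case eA eB sAB nA; [left|right; left].
have [dA'|/existsNP nA] := pselect (bounded_dom (perp A)); last first.
  have sA'B : same_total_strength (perp A) B by move=> x x0; rewrite total_strength_perp sAB.
  have [|/zero'] := unbounded_case eA' eB sA'B nA; last by right; left.
  by rewrite perpK => -[|]; left; [right|left].
have [dB|/existsNP nB] := pselect (bounded_dom B); last first.
  have [|/zero] := unbounded_case eB eA sBA nB; last by right; right.
  by move=> [->|->]; left; [left|right; rewrite perpK].
have [dB'|/existsNP nB] := pselect (bounded_dom (perp B)); last first.
  have sB'A : same_total_strength (perp B) A by move=> x x0; rewrite total_strength_perp sBA.
  have [|/zero'] := unbounded_case eB' eA sB'A nB; last by right; right.
  by rewrite perpK => -[->|->]; left; [right; rewrite perpK|left].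
by have [|] := bounded_case eA eB sAB e0 dA dA' dB dB'; [left|right; left].
Qed.

(** The strengths of [B] and [perp B] along [x] are at most the values of
their forms at [x], normalised, and those add up to the bound assumed.  So
[qf B] minus its rank-one minorant vanishes at [x], where it has a
minimum. *)
Lemma eigenvector B x : effects B -> x != 0 -> (rdot x x)^-1 <= total_strength B x ->
  exists s, B x = s%:C *: x.
Proof.
move=> eB x0 le1; have eB' := perp_effects eB; have r0 := rdot_gt0 x0.
have [sB _] := effects_psd eB.
set l := strength B x; set r := rdot x x in r0 le1.
have hl : forall y, l * rdot y x ^+ 2 <= qf B y.
  by apply/strength_rdotP => //; exact: strength_ge0.
have hl' : strength (perp B) x * r ^+ 2 <= r - qf B x.
  by rewrite -qf_perp; apply: (proj2 (strength_rdotP eB' x0 (strength_ge0 x eB'))).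
have eq : qf B x = l * r ^+ 2.
  apply/le_anti; rewrite hl andbT.
  have : r <= (l + strength (perp B) x) * r ^+ 2.
    have := ler_wpM2r (sqr_ge0 r) le1.
    by rewrite expr2 mulrA mulVf ?mul1r // gt_eqF.
  lra.
exists (l * r); apply: rdot_inj => y; rewrite rdotZl.
apply/eqP; rewrite -subr_eq0; apply/eqP.
apply: (discriminant_null (b := qf B y - l * rdot y x ^+ 2)).
  by rewrite subr_ge0.
move=> s; have := hl (x + s%:C *: y); rewrite qfD // qfZ // !rdotE eq -/r (rdotC x y).
lra.
Qed.

(** With [e] an eigenvector of eigenvalue [s], symmetry gives the
eigenvalue [s] to all vectors that are not orthogonal to [e], and the others
are differences of such vectors. *)
Lemma all_eigenvectors B e : rsym B -> e != 0 ->
  (forall x, x != 0 -> exists s, B x = s%:C *: x) ->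
  homothety B.
Proof.
move=> [BD _ Bs] e0 h; have [s hs] := h e e0; exists s.
have key x : rdot x e != 0 -> B x = s%:C *: x.
  move=> xe; have [t ht] : exists t, B x = t%:C *: x.
    by apply: h; apply: contra xe => /eqP->; rewrite rdot0l.
  have := Bs x e; rewrite ht hs rdotZl rdotZr => /(mulIf xe) ->.
  by [].
move=> x; have [xe|] := eqVneq (rdot x e) 0; last exact: key.
have : B (x + e) = s%:C *: (x + e).
  by apply: key; rewrite rdotDl xe add0r gt_eqF // rdot_gt0.
by rewrite BD hs scalerDr => /addIr.
Qed.

Lemma homothety_scalar A e : effects A -> e != 0 -> homothety A -> scalar_effects A.
Proof.
move=> eA e0 [s hs]; exists s; last by apply/funext => x; rewrite hs.
have r0 := rdot_gt0 e0; have [_ pA] := effects_psd eA.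
have := pA e; have := effects_le eA e; rewrite /qf hs rdotZl.
rewrite pmulr_lge0 // => h1 h0; rewrite h0 /=.
by rewrite -(ler_pM2r r0) mul1r.
Qed.

Lemma effects_scale C t : 0 <= t <= 1 -> effects C -> effects (t%:C *: C).
Proof.
move=> /andP[t0 t1] eC; have [bC sC] := effectsW eC; have [_ pC] := effects_psd eC.
apply/effectsP; split.
- exact: bounded_operatorZ.
- exact: self_adjointZ.
- by move=> x; rewrite qfZop mulr_ge0.
- by move=> x; rewrite qfZop (le_trans _ (effects_le eC x)) // ler_piMl.
Qed.

(** An effect [C] is split as [(1 - t) C + t C], and [t I] as
[t (I - C) + t C]. *)
Lemma scalar_coexistent A C : scalar_effects A -> effects C -> coexistent C A.
Proof.
move=> [t t01 ->] eC; have /andP[t0 t1] := t01; have eC' := perp_effects eC.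
have [bC sC] := effectsW eC; have [bC' sC'] := effectsW eC'.
have [_ pC] := effects_psd eC; have [_ pC'] := effects_psd eC'.
have u01 : 0 <= 1 - t <= 1 by lra.
have CE : C = (1 - t)%:C *: C + t%:C *: C.
  by rewrite rmorphB rmorph1 scalerBl scale1r subrK.
exists ((1 - t)%:C *: C), (t%:C *: perp C), (t%:C *: C); split; split.
- exact: effects_scale.
- exact: effects_scale.
- exact: effects_scale.
- exact: CE.
- by apply/funext => x; rewrite -[RHS]/(t%:C *: perp C x + t%:C *: C x) -scalerDr perpE subrK.
rewrite addrAC -CE; apply/effectsP; split.
- by apply: bounded_operatorD => //; exact: bounded_operatorZ.
- by apply: self_adjointD => //; exact: self_adjointZ.
- by move=> x; rewrite qfDop qfZop addr_ge0 // mulr_ge0.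
- move=> x; rewrite qfDop qfZop -[leRHS](subrK (qf C x)) -qf_perp addrC.
  by rewrite lerD2r ler_piMl.
Qed.

(** If [C = E + G] and [A = F + G], then [I - A] is the sum of [E] and
the complement of [E + F + G]: the roles of [E] and [G] are exchanged. *)
Lemma coexistent_perp A C : coexistent C A -> coexistent C (perp A).
Proof.
move=> [E [F [G [[eE eF eG] [-> -> eS]]]]].
exists G, (perp (E + F + G)), E; split; split=> //.
- exact: perp_effects.
- by rewrite addrC.
- by rewrite /perp -(addrA E F G) (opprD E) [in RHS]addrA [RHS]addrAC subrK.
have -> : G + perp (E + F + G) + E = perp F; last exact: perp_effects.
rewrite /perp (addrAC E F G) [LHS]addrAC (addrC G E) [in LHS]opprD addrCA.
by rewrite (addrA (E + G)) subrr add0r.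
Qed.

Lemma coexistent_set_perp A : coexistent_set (perp A) = coexistent_set A.
Proof.
apply/seteqP; split=> C [eC cC]; split=> //; last exact: coexistent_perp.
by rewrite -[A]perpK; exact: coexistent_perp.
Qed.

Lemma scalar_coexistent_set A : scalar_effects A -> coexistent_set A = effects (H := H).
Proof.
by move=> sA; apply/seteqP; split=> [C []|C eC] //; split=> //; exact: scalar_coexistent.
Qed.

Lemma total_strength_ge0 A x : effects A -> 0 <= total_strength A x.
Proof. by move=> eA; rewrite addr_ge0 ?strength_ge0 //; exact: perp_effects. Qed.

Lemma finite_rank_total_strength A B : effects A -> effects B ->
  coexistent_set A `&` finite_rank_effects `<=` coexistent_set B ->
  forall x t, x != 0 -> 0 <= t -> t <= total_strength A x -> t <= total_strength B x.
Proof.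
move=> eA eB sub x t x0 t0 /(coexistent_rank1 eA x0 t0)[eT cT].
apply/(coexistent_rank1 eB x0 t0); apply: sub; split; split=> //.
exact: rank1_finite.
Qed.

(** All projections on lines coexist with a scalar effect, hence with [B],
and so every vector is an eigenvector of [B]. *)
Lemma scalar_transfer A B e : effects A -> effects B -> e != 0 ->
  coexistent_set A `&` finite_rank_effects `<=` coexistent_set B ->
  scalar_effects A -> homothety B.
Proof.
move=> eA eB e0 sub sA; apply: (all_eigenvectors (effects_rsym eB) e0) => x x0.
have r0 := rdot_gt0 x0; apply: eigenvector => //.
have t0 : 0 <= (rdot x x)^-1 by rewrite invr_ge0 ltW.
apply: (finite_rank_total_strength eA eB sub) => //.
apply/coexistent_rank1 => //.
have eT : effects (rank1 x (rdot x x)^-1).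
  apply: rank1_effects => // y; rewrite mulrC ler_pdivrMr // mulrC.
  exact: cauchy_schwarz.
by split=> //; exact: scalar_coexistent.
Qed.

Lemma coexistent_finite_rank_inj A B e : effects A -> effects B -> e != 0 ->
  coexistent_set A `&` finite_rank_effects = coexistent_set B `&` finite_rank_effects ->
  (B = A \/ B = perp A) \/ (scalar_effects A /\ scalar_effects B).
Proof.
move=> eA eB e0 eqAB.
have sub : coexistent_set A `&` finite_rank_effects `<=` coexistent_set B.
  by rewrite eqAB => C [].
have sub' : coexistent_set B `&` finite_rank_effects `<=` coexistent_set A.
  by rewrite -eqAB => C [].
have sAB : same_total_strength A B.
  move=> x x0; apply/le_anti/andP; split.
    by apply: (finite_rank_total_strength eA eB sub) => //; exact: total_strength_ge0.
  by apply: (finite_rank_total_strength eB eA sub') => //; exact: total_strength_ge0.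
have [|[|] h] := strength_case eA eB sAB e0; [by left| |]; right.
- have sA := homothety_scalar eA e0 h; split=> //.
  by apply: (homothety_scalar eB e0); exact: scalar_transfer eA eB e0 sub sA.
- have sB := homothety_scalar eB e0 h; split=> //.
  by apply: (homothety_scalar eA e0); exact: scalar_transfer eB eA e0 sub' sB.
Qed.

Lemma dim_ge_nonzero n : dim_ge H n.+1 -> exists e : H, e != 0.
Proof.
move=> [v hv]; exists (v ord0); apply/eqP => v0.
have := hv (fun i => (i == ord0)%:R); rewrite big_ord_recl eqxx v0 scaler0 add0r.
rewrite big1 => [/(_ erefl ord0)/eqP|i _]; first by rewrite eqxx oner_eq0.
by rewrite scale0r.
Qed.

End Final.

Theorem theorem1p1 (R : realType) (H : hilbertType R) (dimH : dim_ge H 2)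
    (A B : H -> H) (effA : effects A) (effB : effects B) :
  let i := (B = A \/ B = perp A) \/ (scalar_effects A /\ scalar_effects B) in
  let ii := coexistent_set A = coexistent_set B in
  let iii := coexistent_set A `&` finite_rank_effects =
             coexistent_set B `&` finite_rank_effects in
  (i <-> ii) /\ (separable H -> (i <-> iii) /\ (ii <-> iii)).
Proof.
move=> i ii iii; have [e e0] := dim_ge_nonzero dimH.
have i_ii : i -> ii.
  rewrite /i /ii; case=> [[e1|e1]|[sA sB]]; first by rewrite e1.
    by rewrite e1 coexistent_set_perp.
  by rewrite !scalar_coexistent_set.
have ii_iii : ii -> iii by rewrite /ii /iii => ->.
have iii_i : iii -> i by exact: coexistent_finite_rank_inj e0.
by split; [split; auto|move=> _; split; split; auto].
Qed.
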